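(* Let $G$ and $B$ be disjoint finite sets (identifiers of correct and of Byzantine robots, respectively), let $f=|B|$ and $n=|G|+|B|$, and assume $2f < n \le 3f$ (equivalently, writing $|G|=|b|+2|g|$ and $|B|=|b|+|g|$ for finite sets $b,g$ with $g\neq\emptyset$). Then there is no robogram $r$ for the identifier sets $(G,B)$ that is a solution to the convergence problem, i.e. for every robogram $r$ there exist an initial correct position $gp_0:G\to\mathbb{Q}$, a fair demon $d$ and a rational $\varepsilon>0$ such that for no $\ell\in\mathbb{Q}$ does there exist $N$ with $|\ell - gp_m(x)|\le\varepsilon$ for all $m\ge N$ and all $x\in G$, where $(gp_m)_{m\in\mathbb{N}}$ is the execution of $r$ from $gp_0$ under $d$.
   Context: Model of oblivious, anonymous mobile robots on the rational line. Locations are elements of $\mathbb{Q}$. A position is a pair $(gp,bp)$ with $gp:G\to\mathbb{Q}$ and $bp:B\to\mathbb{Q}$, written $gp\uplus bp$, i.e. a map from $G\cup B$ to $\mathbb{Q}$ (this gives strong multiplicity detection and global visibility). A robogram is a function $r$ from positions to $\mathbb{Q}$ such that $r(p)=r(q)$ whenever $q=p\circ\sigma^{-1}$ for some bijection $\sigma$ of $G\cup B$ (invariance under arbitrary permutations of all robot identifiers). For rationals $k\neq 0$ and $t$, the similarity $[k,t]$ maps a location $x$ to $k(x-t)$, and acts on positions pointwise. A demonic action is a pair $(\beta,\phi)$ with $\beta:B\to\mathbb{Q}$ (positions of the Byzantine robots, chosen arbitrarily) and $\phi:G\to\mathbb{Q}$, where $\phi(x)=0$ means correct robot $x$ is not activated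 and $\phi(x)\neq 0$ means it is activated with scale factor $\phi(x)$. A demon is an infinite sequence $(\beta_i,\phi_i)_{i\in\mathbb{N}}$ of demonic actions (semi-synchronous: any subset of robots may be activated in a round). The demon is fair if every correct robot $x\in G$ is activated ($\phi_i(x)\neq 0$) for infinitely many $i$. Given $gp_0:G\to\mathbb{Q}$, the execution is defined by $gp_{i+1}(x)=gp_i(x)+\frac{1}{k}\, r\big([k,t](gp_i\uplus\beta_i)\big)$ with $k=\phi_i(x)$, $t=gp_i(x)$, if $\phi_i(x)\neq 0$, and $gp_{i+1}(x)=gp_i(x)$ otherwise. A robogram $r$ is a solution (to convergence) if for every initial $gp_0$, every fair demon, and every rational $\varepsilon>0$ there is $\ell\in\mathbb{Q}$ and $N\in\mathbb{N}$ such that $|\ell-gp_m(x)|\le\varepsilon$ for all $m\ge N$ and all $x\in G$. *)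

(* Defs.v *)
From HB Require Import structures.
From mathcomp Require Import all_boot all_order all_fingroup all_algebra.

Set Implicit Arguments.
Unset Strict Implicit.
Unset Printing Implicit Defensive.

Import Order.TTheory GRing.Theory Num.Theory.
Local Open Scope ring_scope.

(* The disjoint union of the identifier sets G (correct robots) and B
   (Byzantine robots) is the sum type G + B. *)
Definition position (G B : finType) : Type := {ffun G + B -> rat}.

Definition posU (G B : finType) (gp : {ffun G -> rat}) (bp : {ffun B -> rat}) :
    position G B :=
  [ffun z => match z with inl x => gp x | inr y => bp y end].

(* Anonymity: the permutation ranges over all identifiers at once, so it may
   exchange correct and Byzantine robots. *)
Record robogram (G B : finType) := Robogram {
  robogram_fun :> position G B -> rat;
  robogram_inv : forall (s : {perm G + B}) (p q : position G B),
    q = [ffun z => p ((s^-1)%g z)] -> robogram_fun p = robogram_fun q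
}.

Definition similarity (k t x : rat) : rat := k * (x - t).

Definition sim_pos (G B : finType) (k t : rat) (p : position G B) :
    position G B :=
  [ffun z => similarity k t (p z)].

(* [scale x = 0] means that the correct robot x is not activated. *)
Record demonic_action (G B : finType) := DemonicAction {
  byz : {ffun B -> rat};
  scale : {ffun G -> rat}
}.

Definition demon (G B : finType) : Type := nat -> demonic_action G B.

Definition fair (G B : finType) (d : demon G B) : Prop :=
  forall (x : G) (i : nat), exists2 j : nat, (i <= j)%N & scale (d j) x != 0.

Definition round (G B : finType) (r : robogram G B) (a : demonic_action G B)
    (gp : {ffun G -> rat}) : {ffun G -> rat} :=
  [ffun x => let k := scale a x in let t := gp x in
     if k == 0 then t
     else t + k^-1 * r (sim_pos k t (posU gp (byz a)))].

Fixpoint execution (G B : finType) (r : robogram G B) (d : demon G B)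
    (gp0 : {ffun G -> rat}) (i : nat) : {ffun G -> rat} :=
  if i is j.+1 then round r (d j) (execution r d gp0 j) else gp0.

Definition eventually_within (G : finType) (gp : nat -> {ffun G -> rat})
    (eps l : rat) : Prop :=
  exists N : nat, forall (m : nat) (x : G), (N <= m)%N -> `|l - gp m x| <= eps.

(* The point l may depend on eps. *)
Definition solution (G B : finType) (r : robogram G B) : Prop :=
  forall (gp0 : {ffun G -> rat}) (d : demon G B), fair d ->
  forall eps : rat, 0 < eps ->
  exists l : rat, eventually_within (execution r d gp0) eps l.

(* Main.v *)
(** Call a view balanced if [|G|] robots, including the observer, are at [0] and
    the other [|B|] robots are at [1].  By anonymity [r] has a single value [m]
    on balanced views.

    If [m <> 0], start with all correct robots together and keep the Byzantine
    robots one unit ahead: every round translates the correct robots by [m], so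
    they run off to infinity.

    If [m = 0], split the correct robots into [|B|] at [0] and [|G| - |B|] at
    [1].  Before activating either group the Byzantine robots can complete it to
    [|G|] robots (this uses [|G| <= 2 |B|]), so the activated robots have a
    balanced view and stay where they are.  Activating the two groups
    alternately is fair and leaves them at distance [1] forever. *)

Require Import Defs.
From HB Require Import structures.
From mathcomp Require Import all_boot all_order all_fingroup all_algebra.
From mathcomp Require Import zify ring lra.

Import Order.TTheory GRing.Theory Num.Theory.
Local Open Scope ring_scope.

Lemma exists_set_card {T : finType} (k : nat) :
  (k <= #|T|)%N -> exists A : {set T}, #|A| = k.
Proof.
move=> le_kT; exists [set enum_val (widen_ord le_kT i) | i : 'I_k].
rewrite card_imset ?card_ord // => i j /enum_val_inj /(congr1 val) /= eq_ij.
exact: val_inj.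
Qed.

(** List each set followed by its complement. Sending the entry at each index of the list for [C] to
    the entry at that index of the list for [A] is a bijection, and it respects the sets because
    both lists switch to the complement at the same index. *)
Lemma exists_perm_mem {T : finType} (A C : {set T}) :
  #|A| = #|C| -> exists s : {perm T}, forall z, (s z \in A) = (z \in C).
Proof.
move=> cAC.
pose e (D : {set T}) := enum D ++ enum (~: D).
have size_e D : size (e D) = #|T| by rewrite size_cat -!cardE cardsC.
have uniq_e D : uniq (e D).
  rewrite cat_uniq !enum_uniq andbT /=; apply/hasPn => z.
  by rewrite !mem_enum inE.
have mem_e D z : z \in e D by rewrite mem_cat !mem_enum inE orbN.
pose f z := nth z (e A) (index z (e C)).
have idx_lt z : (index z (e C) < size (e A))%N.
  by rewrite size_e -(size_e C) index_mem.
have inj_f : injective f.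
  move=> x y; rewrite /f (set_nth_default x y) // => /eqP.
  by rewrite nth_uniq // => /eqP /(congr1 (nth x (e C))); rewrite !nth_index.
exists (perm inj_f) => z; rewrite permE /f.
rewrite nth_cat -cardE cAC [X in (X < _)%N]index_cat mem_enum.
case zC: (z \in C); last first.
  rewrite -cardE ltnNge leq_addr /= /e index_cat mem_enum zC -cardE addKn.
  have : nth z (enum (~: A)) (index z (enum (~: C))) \in enum (~: A).
    have cACC : #|~: A| = #|~: C| by rewrite [LHS]cardsCs [RHS]cardsCs !setCK cAC.
    by rewrite mem_nth // -cardE cACC cardE index_mem mem_enum inE zC.
  by rewrite mem_enum inE => /negbTE.
have lt_i : (index z (enum C) < #|C|)%N by rewrite cardE index_mem mem_enum.
rewrite lt_i /e index_cat mem_enum zC.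
by rewrite -mem_enum mem_nth // -cardE cAC.
Qed.

Section TwoPointViews.

Context {G B : finType}.

Definition sum_set (X : {set G}) (Y : {set B}) : {set G + B} :=
  [set z | match z with inl x => x \in X | inr y => y \in Y end].

Lemma card_sum_set X Y : #|sum_set X Y| = (#|X| + #|Y|)%N.
Proof.
rewrite -!sum1_card big_mkcond big_sumType /=.
by congr (_ + _)%N; rewrite [RHS]big_mkcond; apply: eq_bigr => z _; rewrite inE.
Qed.

(** [S] is the set of robots at 0; all others are at 1. *)
Definition two_point (S : {set G + B}) : position G B :=
  [ffun z => (z \notin S)%:R].

Lemma robogram_two_point (r : robogram G B) (S S' : {set G + B}) :
  #|S| = #|S'| -> r (two_point S) = r (two_point S').
Proof.
move=> /exists_perm_mem [s sP].
apply: (robogram_inv r (s := s^-1)%g).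
by apply/ffunP => z; rewrite !ffunE invgK sP.
Qed.

Definition indicator_out {T : finType} (X : {set T}) : {ffun T -> rat} :=
  [ffun x => (x \notin X)%:R].

Lemma sim_two_point X Y :
  sim_pos 1 0 (posU (indicator_out X) (indicator_out Y)) =
  two_point (sum_set X Y).
Proof.
by apply/ffunP => -[z|z]; rewrite !ffunE inE /similarity subr0 mul1r.
Qed.

(** Scale -1 about 1 is the reflection exchanging 0 and 1, so an observer at 1 also sees its own
    group at 0. *)
Lemma sim_two_pointC X Y :
  sim_pos (-1) 1 (posU (indicator_out X) (indicator_out Y)) =
  two_point (sum_set (~: X) (~: Y)).
Proof.
by apply/ffunP => -[z|z]; rewrite !ffunE !inE /similarity;
  case: (_ \in _); rewrite /=; ring.
Qed.

Lemma robogram_escape (r : robogram G B) (x0 : G) :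
  r (two_point (sum_set setT set0)) != 0 ->
  exists (gp0 : {ffun G -> rat}) (d : demon G B) (eps : rat),
    [/\ fair d, 0 < eps &
        forall l : rat, ~ eventually_within (execution r d gp0) eps l].
Proof.
set m := r _ => m_neq0.
pose d : demon G B := fun i =>
  DemonicAction [ffun=> i%:R * m + 1] [ffun=> 1].
have execE i : execution r d [ffun=> 0] i = [ffun=> i%:R * m].
  elim: i => [|i IHi] /=; first by apply/ffunP => x; rewrite !ffunE mul0r.
  rewrite IHi; apply/ffunP => x; rewrite [LHS]ffunE /= !ffunE oner_eq0.
  suff -> : sim_pos 1 (i%:R * m) (posU [ffun=> i%:R * m] [ffun=> i%:R * m + 1]) =
            two_point (sum_set setT set0).
    by rewrite -/m invr1 -natr1; ring.
  by apply/ffunP => -[z|z]; rewrite !ffunE !inE /similarity /=; ring.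
(* Two consecutive positions within [|m| / 3] of [l] would be at most [2|m| / 3] apart, but they
   differ by [m]. *)
exists [ffun=> 0], d, (`|m| / 3); split.
- by move=> x i; exists i; rewrite // ffunE oner_eq0.
- by rewrite divr_gt0 ?normr_gt0.
move=> l [N close].
have := close N x0 (leqnn N); have := close N.+1 x0 (leqnSn N).
rewrite !execE !ffunE -natr1 => h1 h2.
have : `|m| <= `|m| / 3 + `|m| / 3.
  apply: le_trans (lerD h2 h1); apply: le_trans (ler_normB _ _).
  by rewrite le_eqVlt; apply/orP; left; apply/eqP; congr `|_|; ring.
have := m_neq0; rewrite -normr_gt0; lra.
Qed.

Lemma robogram_stuck (r : robogram G B) (X : {set G}) (Y : {set B}) (x0 x1 : G) :
  x0 \in X -> x1 \notin X ->
  r (two_point (sum_set X Y)) = 0 ->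
  r (two_point (sum_set (~: X) setT)) = 0 ->
  exists (gp0 : {ffun G -> rat}) (d : demon G B) (eps : rat),
    [/\ fair d, 0 < eps &
        forall l : rat, ~ eventually_within (execution r d gp0) eps l].
Proof.
move=> x0X x1X rX rXC.
(* Even rounds activate [X] at 0, with [Y] joining it there; odd rounds activate the robots at 1
   with scale -1, all Byzantine robots being at 1 since [indicator_out set0] is constantly 1. *)
pose d : demon G B := fun i =>
  if odd i then DemonicAction (indicator_out set0) [ffun x => - (x \notin X)%:R]
  else DemonicAction (indicator_out Y) [ffun x => (x \in X)%:R].
have execE i : execution r d (indicator_out X) i = indicator_out X.
  elim: i => [//|i IHi] /=; rewrite IHi; apply/ffunP => x.
  rewrite [LHS]ffunE /d; case: (odd i); rewrite /= !ffunE.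
  - case: (x \in X); rewrite /= ?oppr0 ?eqxx //.
    by rewrite sim_two_pointC setC0 rXC mulr0 addr0.
  - case: (x \in X); rewrite /= ?eqxx //.
    by rewrite sim_two_point rX mulr0 addr0.
exists (indicator_out X), d, (1 / 3); split => //.
- move=> x i.
  (* The added boolean selects the parity of the rounds that activate [x]. *)
  exists (i.*2 + (x \notin X))%N; first by rewrite -addnn -addnA leq_addr.
  rewrite /d oddD odd_double /=.
  by case xX: (x \in X); rewrite /= ffunE xX ?oppr_eq0 oner_eq0.
move=> l [N close].
have := close N x0 (leqnn N); have := close N x1 (leqnn N).
rewrite !execE !ffunE x0X x1X /= !ler_norml => /andP[? ?] /andP[? ?]; lra.
Qed.

End TwoPointViews.

Theorem mainTheorem1 (G B : finType)
    (hn : (2 * #|B| < #|G| + #|B|)%N) (hf : (#|G| + #|B| <= 3 * #|B|)%N) :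
  ~ (exists r : robogram G B, solution r) /\
  (forall r : robogram G B,
     exists (gp0 : {ffun G -> rat}) (d : demon G B) (eps : rat),
       [/\ fair d, 0 < eps &
           forall l : rat, ~ eventually_within (execution r d gp0) eps l]).
Proof.
suff no_sol : forall r : robogram G B,
     exists (gp0 : {ffun G -> rat}) (d : demon G B) (eps : rat),
       [/\ fair d, 0 < eps &
           forall l : rat, ~ eventually_within (execution r d gp0) eps l].
  split=> // -[r sol_r]; have [gp0 [d [eps [fair_d eps0 noncv]]]] := no_sol r.
  by have [l /noncv] := sol_r gp0 d fair_d eps eps0.
move=> r.
have [|X cX] := @exists_set_card G #|B|; first lia.
(* The size of [Y] makes [X] and [Y] together count [#|G|] robots; it fits into [B] because
   [#|G| <= 2 * #|B|]. *)
have [|Y cY] := @exists_set_card B (#|G| - #|B|)%N; first lia.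
have cXC : #|~: X| = (#|G| - #|B|)%N by rewrite cardsCs setCK cX.
have /card_gt0P[x0 x0X] : (0 < #|X|)%N by lia.
have /card_gt0P[x1] : (0 < #|~: X|)%N by lia.
rewrite inE => x1X.
have [m0|] := eqVneq (r (two_point (sum_set setT set0))) 0; last first.
  exact: robogram_escape.
(* Both views have exactly [#|G|] robots at 0, so anonymity gives them the same value as the
   balanced view. *)
apply: (@robogram_stuck _ _ r X Y x0 x1) => //; rewrite -m0;
  apply: robogram_two_point; rewrite !card_sum_set ?cX ?cY ?cXC !cardsT cards0.
all: lia.
Qed.
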